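(* Let $N\ge 1$, let $L^*$ be a real symmetric positive definite $N\times N$ matrix, and let $\Phi=\Phi_{L^*}$ be the expected log-likelihood function. Then the null space of the quadratic Hessian map $H\mapsto \mathrm{d}^2\Phi(L^* )(H,H)$, defined on the space $\mathcal S_{[N]}$ of real symmetric $N\times N$ matrices (that is, the set of $H\in\mathcal S_{[N]}$ with $\mathrm{d}^2\Phi(L^* )(H,H)=0$), is $$\mathcal N(L^* )=\{H\in\mathcal S_{[N]}: H_{i,j}=0 \text{ for all } i,j\in[N] \text{ such that } i\sim_{L^*} j\}.$$ In particular, $\mathrm{d}^2\Phi(L^* )$ is negative definite if and only if $L^*$ is irreducible.
   Context: Notation: $[N]=\{1,\dots,N\}$; $\mathcal S_{[N]}$ is the space of real symmetric $N\times N$ matrices and $\mathcal S_{[N]}^{++}$ its open subset of positive definite matrices. For a matrix $A$ and $J\subset[N]$, $A_J$ is the principal submatrix indexed by $J$, with $\det A_\emptyset=1$. For $L\in\mathcal S_{[N]}^{++}$, the determinantal point process $\mathsf{DPP}(L)$ is the law of a random subset $Z\subset[N]$ with $\mathbb P[Z=J]=p_J(L)=\det(L_J)/\det(I+L)$ for all $J\subset[N]$. Expected log-likelihood: for $L\in\mathcal S_{[N]}^{++}$, $\Phi_{L^*}(L)=\sum_{J\subset[N]}p_J(L^* )\log\det(L_J)-\log\det(I+L)$. $\mathrm{d}^2\Phi(L^* )$ denotes its second derivative at $L^*$, a symmetric bilinear form on $\mathcal S_{[N]}$. Determinantal graph: $\mathcal G_{L}$ is the undirected graph on $[N]$ with an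 edge $\{i,j\}$ whenever $L_{i,j}\ne0$; $i\sim_L j$ means that there is a path in $\mathcal G_L$ connecting $i$ and $j$ (in particular $i\sim_L i$). Irreducibility: let $\mathcal D$ be the set of $N\times N$ diagonal matrices with diagonal entries $\pm1$. $L$ is irreducible if the set $\{DLD: D\in\mathcal D\}$ has cardinality $2^{N-1}$ (equivalently, $\mathcal G_L$ is connected). *)

(* Defs.v *)
From HB Require Import structures.
From mathcomp Require Import all_boot all_order all_algebra.
From mathcomp Require Import all_classical all_reals all_analysis.

Set Implicit Arguments.
Unset Strict Implicit.
Unset Printing Implicit Defensive.

Import Order.TTheory GRing.Theory Num.Theory.
Import numFieldNormedType.Exports.

Local Open Scope classical_set_scope.
Local Open Scope card_scope.
Local Open Scope ring_scope.

(* Real symmetric matrices form a normed space of their own (with the norm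
   inherited from 'M[R]_N), so that a function on them can be differentiated
   without choosing an extension to non-symmetric matrices. *)
Section SymSpace.
Variables (R : realType) (N : nat).

Definition is_sym : {pred 'M[R]_N} := [pred A | A \is symmetricmx].

Lemma is_symE (A : 'M[R]_N) : (A \in is_sym) = (A^T == A).
Proof.
by rewrite inE /= is_hermitianmxE expr0 scale1r map_mx_id // eq_sym.
Qed.

Fact is_sym_submod_closed : submod_closed is_sym.
Proof.
split=> [|a A B]; rewrite !is_symE; first by rewrite trmx0.
by move=> /eqP hA /eqP hB; rewrite linearP /= hA hB.
Qed.

HB.instance Definition _ :=
  GRing.isSubmodClosed.Build R 'M[R]_N is_sym is_sym_submod_closed.

Record sym := Sym { sym_val :> 'M[R]_N; _ : sym_val \in is_sym }.

HB.instance Definition _ := [isSub for sym_val].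
HB.instance Definition _ := [Choice of sym by <:].
HB.instance Definition _ := [SubChoice_isSubLmodule of sym by <:].

Definition sym_norm (A : sym) : R := `|sym_val A|.

Fact sym_normD (A B : sym) : sym_norm (A + B) <= sym_norm A + sym_norm B.
Proof. exact: ler_normD. Qed.

Fact sym_normZ (a : R) (A : sym) : sym_norm (a *: A) = `|a| * sym_norm A.
Proof. exact: normrZ. Qed.

Fact sym_norm0_eq0 (A : sym) : sym_norm A = 0 -> A = 0.
Proof. by move=> /normr0_eq0 A0; apply: val_inj. Qed.

HB.instance Definition _ :=
  Lmodule_isNormed.Build R sym sym_normD sym_normZ sym_norm0_eq0.

End SymSpace.

Section Likelihood.
Variables (R : realType) (N : nat).
Implicit Types (A L : 'M[R]_N) (J : {set 'I_N}).

Definition posdef (A : sym R N) : Prop :=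
  forall x : 'cV[R]_N, x != 0 -> 0 < (x^T *m A *m x) 0 0.

(* Rows and columns are listed in increasing order; for J = set0 this is the
   0 x 0 matrix, of determinant 1. *)
Definition principal A J : 'M[R]_#|J| :=
  \matrix_(i, j) A (enum_val i) (enum_val j).

Definition dpp_prob L J : R := \det (principal L J) / \det (1%:M + L).

(* Meaningful on the open set of positive definite matrices; since [ln] is
   total, the formula also gives irrelevant values elsewhere. *)
Definition loglik (Lstar : 'M[R]_N) (L : sym R N) : R :=
  (\sum_(J : {set 'I_N}) dpp_prob Lstar J * ln (\det (principal L J)))
  - ln (\det (1%:M + L)).

Definition det_graph L : rel 'I_N := [rel i j | (i != j) && (L i j != 0)].

Definition graph_equiv L (i j : 'I_N) : bool := connect (det_graph L) i j.

Definition sign_diag : set 'M[R]_N :=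
  [set D | is_diag_mx D /\ forall i, D i i = 1 \/ D i i = -1].

Definition irreducible L : Prop :=
  [set D *m L *m D | D in sign_diag] #= `I_(2 ^ N.-1)%N.

End Likelihood.

(* Second Frechet derivative: d^2 f(x)(h, k) = d(y |-> d f(y)(k))(x)(h). *)
Definition diff2 (R : realType) (V W : normedModType R) (f : V -> W) (x : V)
    (h k : V) : W :=
  'd (fun y : V => 'd f y k) x h.

Definition hess (R : realType) (N : nat) (Lstar H K : sym R N) : R :=
  diff2 (loglik Lstar : sym R N -> R^o) Lstar H K.

(* Main.v *)
(* Since p_J(L) = det(L_J) / det(I+L) and the principal minors sum to det(I+L),
   the second derivative of the expected log-likelihood at Lstar is
   - Var(D log det(L_Z)(H)) for Z ~ DPP(Lstar). As p_J > 0 for all J and the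
   derivative vanishes for J empty, the variance is zero exactly when
   D det(L_J)(H_J) = 0 for every J.
   If H vanishes on each connected component, all these derivatives are zero,
   because a permutation whose steps but one follow edges of the graph closes up
   inside a component. Conversely, let i and j be at graph distance n and let J
   be the vertices of a geodesic: L_J is tridiagonal and, by induction on n, H_J
   only has the corner entries H_ij, so D det(L_J)(H_J) is a nonzero multiple of
   H_ij. For irreducibility, two sign matrices give the same conjugate of Lstar if
   and only if their ratio is constant on connected components. *)

From HB Require Import structures.
Require Import Defs.
From mathcomp Require Import all_boot all_order all_algebra.
From mathcomp Require Import all_classical all_reals all_analysis.
From mathcomp Require Import fingroup perm.
From mathcomp Require Import ring lra zify.

Set Implicit Arguments.
Unset Strict Implicit.
Unset Printing Implicit Defensive.

Import Order.TTheory GRing.Theory Num.Theory.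
Import numFieldNormedType.Exports.

Local Open Scope classical_set_scope.
Local Open Scope card_scope.
Local Open Scope ring_scope.

(** * Principal minors *)

Section PrincipalMinors.
Variable R : comNzRingType.

Lemma det_mxsub_perm n (s : 'S_n) (A : 'M[R]_n) : \det (mxsub s s A) = \det A.
Proof.
have -> : mxsub s s A = row_perm s (col_perm s A).
  by apply/matrixP => i j; rewrite !mxE.
rewrite row_permE col_permE !det_mulmx !det_perm odd_permV mulrCA mulrA.
by rewrite -mulrA -expr2 sqrr_sign mulr1.
Qed.

(** Two injective enumerations of the same index set differ by a permutation. Principal minors can
    thus be computed in any convenient order of the indices. *)
Lemma det_mxsub_codom n m N (v : 'I_n -> 'I_N) (w : 'I_m -> 'I_N)
    (A : 'M[R]_N) : injective v -> injective w -> codom v =i codom w ->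
  \det (mxsub v v A) = \det (mxsub w w A).
Proof.
move=> vI wI vw.
have nm : n = m.
  by rewrite -[n]card_ord -[m]card_ord -(card_codom vI) -(card_codom wI); apply: eq_card.
case: _ / nm w wI vw => w wI vw.
have vwP i : v i \in codom w by rewrite -vw codom_f.
pose s i := iinv (vwP i).
have wsE i : w (s i) = v i by exact: f_iinv.
have sI : injective s by move=> i j /(congr1 w); rewrite !wsE => /vI.
rewrite -(det_mxsub_perm (perm sI) (mxsub w w A)); congr (\det _).
by apply/matrixP => i j; rewrite !mxE !permE !wsE.
Qed.

(** Multilinearity in the rows: in each Leibniz term the product of sums is distributed, [J]
    recording the rows taken from [A]. *)
Lemma det_addmx_rows n (A B : 'M[R]_n) : \det (A + B) =
  \sum_(J : {set 'I_n}) \det (\matrix_(i, j) if i \in J then A i j else B i j).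
Proof.
rewrite exchange_big /=; apply: eq_bigr => s _; rewrite -mulr_sumr.
congr (_ * _).
under eq_bigr => i _ do rewrite mxE.
rewrite bigA_distr; apply: eq_big => [J|J _]; first by rewrite ?inE.
by apply: eq_bigr => i _; rewrite mxE.
Qed.

(** Listing [J] before its complement makes the matrix block upper triangular, with an identity
    block in the lower right corner. *)
Lemma det_identity_rows n (A : 'M[R]_n) (J : {set 'I_n}) :
  \det (\matrix_(i, j) if i \in J then A i j else (1%:M : 'M[R]_n) i j) =
  \det (mxsub (enum_val : 'I_#|J| -> 'I_n) enum_val A).
Proof.
set M := \matrix_(i, j) _.
pose v (k : 'I_(#|J| + #|~: J|)) : 'I_n :=
  match fintype.split k with inl i => enum_val i | inr i => enum_val i end.
have vl i : v (lshift _ i) = enum_val i by rewrite /v (unsplitK (inl i)).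
have vr i : v (rshift _ i) = enum_val i by rewrite /v (unsplitK (inr i)).
have vI : injective v.
  move=> i j; rewrite -[i]splitK -[j]splitK.
  case: (fintype.split i) => a; case: (fintype.split j) => b /=; rewrite ?vl ?vr.
  - by move=> /enum_val_inj ->.
  - by have := enum_valP b; rewrite inE => /negP nb h; case: nb; rewrite -h enum_valP.
  - by have := enum_valP a; rewrite inE => /negP nb h; case: nb; rewrite h enum_valP.
  - by move=> /enum_val_inj ->.
have vS x : x \in codom v.
  have [xJ|xJ] := boolP (x \in J).
    by rewrite -[x](enum_rankK_in xJ xJ) -vl codom_f.
  have xJ' : x \in ~: J by rewrite inE.
  by rewrite -[x](enum_rankK_in xJ' xJ') -vr codom_f.
have -> : \det M = \det (mxsub id id M).
  by congr (\det _); apply/matrixP => i j; rewrite !mxE.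
rewrite -(@det_mxsub_codom _ _ _ v id) //; last first.
  by move=> x; rewrite vS; apply/esym/codomP; exists x.
rewrite -[mxsub v v M]submxK.
have -> : dlsubmx (mxsub v v M) = 0.
  apply/matrixP => i j; rewrite !mxE vl vr.
  have := enum_valP i; rewrite inE => /negPf ni; rewrite ni.
  by case: eqP => // h; have := enum_valP j; rewrite -h ni.
have -> : drsubmx (mxsub v v M) = 1%:M.
  apply/matrixP => i j; rewrite !mxE !vr.
  have := enum_valP i; rewrite inE => /negPf ->.
  by rewrite (inj_eq enum_val_inj).
rewrite det_ublock det1 mulr1; congr (\det _); apply/matrixP => i j.
by rewrite !mxE !vl enum_valP.
Qed.

End PrincipalMinors.

Section Principal.
Variables (R : realType) (N : nat).
Implicit Types (A B : 'M[R]_N) (J : {set 'I_N}).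

Lemma principalE A J : principal A J = mxsub enum_val enum_val A.
Proof. by apply/matrixP => i j; rewrite !mxE. Qed.

Lemma det_add1_principal A :
  \det (1%:M + A) = \sum_(J : {set 'I_N}) \det (principal A J).
Proof.
rewrite addrC det_addmx_rows; apply: eq_bigr => J _.
by rewrite det_identity_rows principalE.
Qed.

Lemma det_principal_codom n (v : 'I_n -> 'I_N) A :
  injective v -> \det (principal A [set v i | i : 'I_n]) = \det (mxsub v v A).
Proof.
move=> vI; rewrite principalE; apply: det_mxsub_codom => //; first exact: enum_val_inj.
move=> x; apply/codomP/codomP => [[i ->]|[i ->]].
  by have /imsetP[j _ ->] := enum_valP i; exists j.
have vi : v i \in [set v i | i : 'I_n] by apply: imset_f.
by exists (enum_rank_in vi (v i)); rewrite enum_rankK_in.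
Qed.

End Principal.

(** * Positivity of the principal minors *)

Section PosDef.
Variable R : realType.

(** Along the segment from the identity to [A], the determinant is a polynomial in [t] equal to 1 at
    0. If it were nonpositive at 1, it would vanish at some [t] in [0, 1]; a kernel vector there
    contradicts the positivity of both quadratic forms. *)
Lemma det_gt0_posdef n (A : 'M[R]_n) :
  (forall x : 'cV[R]_n, x != 0 -> 0 < (x^T *m A *m x) 0 0) -> 0 < \det A.
Proof.
move=> Apos; rewrite ltNge; apply/negP => detA.
pose P : 'M[{poly R}]_n := \matrix_(i, j) ((1 - 'X) * (i == j)%:R + 'X * (A i j)%:P).
have PE t : (\det P).[t] = \det ((1 - t) *: 1%:M + t *: A).
  rewrite -[LHS]/(horner_eval t _) -det_map_mx; congr (\det _).
  apply/matrixP => i j; rewrite !mxE /= /horner_eval !hornerE.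
  by rewrite hornerMn !hornerE.
have [|t /andP[t0 t1] /rootP] := @poly_ivt _ (- \det P) 0 1 ler01.
  rewrite !hornerN !PE subr0 subrr scale1r !scale0r addr0 add0r scale1r det1.
  by rewrite oppr_le0 ler01 oppr_ge0.
rewrite hornerN PE => /eqP; rewrite oppr_eq0 => /det0P[x x0 xM].
have := congr1 (fun y : 'rV_n => (y *m x^T) 0 0) xM.
rewrite mul0mx [RHS]mxE mulmxDr mulmxDl -!scalemxAr -!scalemxAl mulmx1 !mxE.
have xT0 : x^T != 0 by rewrite -trmx0 (inj_eq trmx_inj).
have /= := Apos _ xT0; rewrite trmxK !mxE => xA.
have xx : 0 < \sum_j x 0 j * x^T j 0.
  have /rV0Pn[j xj] := x0.
  rewrite (bigD1 j) //= !mxE ltr_wpDr //.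
    by apply: sumr_ge0 => k _; rewrite mxE -expr2 sqr_ge0.
  by rewrite -expr2 lt_def sqrf_eq0 xj sqr_ge0.
move=> h; move: h xA xx; set a := \sum_j _; set b := \sum_j _ => h xA xx.
have : 0 <= (1 - t) * a by rewrite mulr_ge0 ?subr_ge0 ?(ltW xx).
have : 0 <= t * b by rewrite mulr_ge0 // ltW.
move: t0 t1 h xA xx; clear; nra.
Qed.

Lemma det_principal_gt0 N (A : sym R N) (J : {set 'I_N}) :
  posdef A -> 0 < \det (principal A J).
Proof.
move=> Apos; apply: det_gt0_posdef => x x0.
(* [E] selects the coordinates in [J]; as [E *m E^T] is the identity, [E^T] maps nonzero vectors to
   nonzero vectors. *)
pose E : 'M[R]_(#|J|, N) := rowsub enum_val 1%:M.
have rowE m (B : 'M[R]_(N, m)) : E *m B = rowsub enum_val B.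
  by rewrite mul_rowsub_mx mul1mx.
have -> : principal A J = E *m A *m E^T.
  apply: trmx_inj; rewrite trmx_mul trmxK !rowE; apply/matrixP => i j.
  by rewrite !mxE.
have EE : E *m E^T = 1%:M.
  rewrite rowE; apply/matrixP => i j.
  by rewrite !mxE (inj_eq enum_val_inj) eq_sym.
have y0 : E^T *m x != 0.
  by apply: contra_neq x0 => /(congr1 (mulmx E)); rewrite mulmxA EE mul1mx mulmx0.
by have := Apos _ y0; rewrite trmx_mul trmxK !mulmxA.
Qed.
End PosDef.

(** * Differentials of determinants *)

Section Ddet.
Variable R : comNzRingType.

(* The derivative of [\det] at [A] in the direction [B], by Jacobi's formula. *)
Definition ddet n (A B : 'M[R]_n) : R := \sum_i \sum_j B i j * cofactor A i j.

(** The permutations are grouped by their value [j] at [i]; each group is the Leibniz expansion of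
    the cofactor at [(i, j)]. *)
Lemma ddetE n (A B : 'M[R]_n) : ddet A B =
  \sum_(s : 'S_n) (-1) ^+ s * \sum_i (B i (s i) * \prod_(k | k != i) A k (s k)).
Proof.
under [RHS]eq_bigr do rewrite mulr_sumr.
rewrite exchange_big; apply: eq_bigr => i _ /=.
rewrite [RHS](partition_big (fun s : 'S_n => s i) predT) //=.
apply: eq_bigr => j _; rewrite expand_cofactor mulr_sumr.
apply: eq_bigr => s /eqP <-; rewrite mulrCA; congr (_ * (_ * _)).
by apply: eq_bigl => k; rewrite eq_sym.
Qed.

End Ddet.

Section Differentials.
Variables (R : realType) (V : normedModType R).
Implicit Types (f df : V -> R^o) (x : V).

Lemma is_diff_ext f g df dg x : f =1 g -> df =1 dg ->
  is_diff x f df -> is_diff x g dg.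
Proof. by move=> /funext <- /funext <-. Qed.

Lemma is_diff_sum (I : Type) (s : seq I) (P : pred I) (f df : I -> V -> R^o) x :
  (forall i, P i -> is_diff x (f i) (df i)) ->
  is_diff x (fun y => \sum_(i <- s | P i) f i y : R^o)
            (fun h => \sum_(i <- s | P i) df i h : R^o).
Proof.
move=> fd; elim: s => [|i s IH].
  by apply: (@is_diff_ext (cst 0) _ 0) => y; rewrite big_nil.
have [Pi|nPi] := boolP (P i); last first.
  by apply: is_diff_ext IH => y; rewrite big_cons (negPf nPi).
apply: is_diff_ext (is_diffD (fd i Pi) IH) => y; by rewrite big_cons Pi.
Qed.

Lemma is_diff_mul (f g df dg : V -> R^o) x : is_diff x f df -> is_diff x g dg ->
  is_diff x (fun y => f y * g y : R^o) (fun h => df h * g x + f x * dg h : R^o).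
Proof.
move=> fd gd; apply: is_diff_ext (is_diffM fd gd) => y //.
by rewrite fctE addrC mulrC.
Qed.

(** Uniqueness of [s] ensures that the filter [j != i] drops only the differentiated factor. *)
Lemma is_diff_prod (I : eqType) (s : seq I) (f df : I -> V -> R^o) x :
  uniq s -> (forall i, is_diff x (f i) (df i)) ->
  is_diff x (fun y => \prod_(i <- s) f i y : R^o)
    (fun h => \sum_(i <- s) df i h * \prod_(j <- s | j != i) f j x : R^o).
Proof.
move=> + fd; elim: s => [_|i s IH /= /andP[is_ us]].
  by apply: (@is_diff_ext (cst 1) _ 0) => y; rewrite big_nil.
apply: is_diff_ext (is_diff_mul (fd i) (IH us)) => h; first by rewrite big_cons.
rewrite big_cons big_cons eqxx /=; congr (_ + _).
  congr (_ * _); rewrite [LHS]big_seq [RHS]big_seq_cond; apply: eq_bigl => j.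
  by case: (boolP (j \in s)) => //= js; apply/esym; apply: contraNneq is_ => <-.
rewrite mulr_sumr [LHS]big_seq [RHS]big_seq; apply: eq_bigr => j js.
rewrite big_cons ifT; last by apply: contraNneq is_ => ->.
by rewrite mulrCA.
Qed.

Lemma is_diff_mulc (a : R) f df x : is_diff x f df ->
  is_diff x (fun y => a * f y : R^o) (fun h => a * df h : R^o).
Proof. by move=> fd; exact: (is_diffZ a fd). Qed.

Lemma is_diff_det n (A dA : V -> 'M[R]_n) x :
  (forall i j, is_diff x (fun y => A y i j : R^o) (fun h => dA h i j : R^o)) ->
  is_diff x (fun y => \det (A y) : R^o) (fun h => ddet (A x) (dA h) : R^o).
Proof.
move=> Ad.
have D : is_diff x (fun y => \det (A y) : R^o) (fun h => \sum_(s : 'S_n)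
    (-1) ^+ s * \sum_i (dA h i (s i) * \prod_(k | k != i) A x k (s k)) : R^o).
  apply: is_diff_sum => s _; apply: is_diff_mulc.
  apply: (@is_diff_prod _ _ (fun i y => A y i (s i)) (fun i h => dA h i (s i))).
  exact: index_enum_uniq.
by apply: is_diff_ext D => // h; rewrite ddetE.
Qed.

(** Needed for second derivatives: the formula for the gradient of the log-likelihood is only
    established near [x], where the arguments of [ln] stay positive. *)
Lemma diff_near_eq (f g : V -> R^o) x : (\near x, f x = g x) ->
  differentiable g x -> 'd f x = 'd g x :> (V -> R^o).
Proof.
move=> fg dg; have cdg := diff_continuous dg; apply: diff_unique => //.
have fgx : f x = g x by exact: (nbhs_singleton fg).
apply/eqaddoP => _/posnumP[e]; have := diff_locally dg.
move=> /eqaddoP /(_ e%:num (gt0 e)) H.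
have fg' : \forall h \near (0 : V), f (h + x) = g (h + x).
  have := fg; rewrite (near_shift 0 x).
  by apply: filterS => h /=; rewrite subr0.
near=> h.
have -> : (f \o shift x - (cst (f x) + 'd g x)) h =
   (g \o shift x - (cst (g x) + 'd g x)) h.
  rewrite !fctE /= fgx; congr (_ - _).
  by near: h.
by near: h.
Unshelve. all: by end_near. Qed.

End Differentials.

(** * The Hessian of a log-likelihood *)

Section LogDifferentials.
Variables (R : realType) (V : normedModType R).

Lemma is_diff_ln (f df : V -> R^o) x : 0 < f x -> is_diff x f df ->
  is_diff x (fun y => ln (f y) : R^o) (fun h => df h / f x : R^o).
Proof.
move=> fx fd; have lnd := is_derive1_ln fx.
have dln : differentiable (@ln R : R -> R) (f x).
  by apply/derivable1_diffP; have [] := lnd.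
have lnE : is_diff (f x) (@ln R : R^o -> R^o) (fun h => h / f x : R^o).
  apply: DiffDef => //; rewrite diff1E //; apply/funext => h.
  by rewrite derive1E (@derive_val _ _ _ _ _ _ _ lnd).
exact: (is_diff_comp fd lnE).
Qed.

Lemma is_diff_div (f g df dg : V -> R^o) x : g x != 0 ->
  is_diff x f df -> is_diff x g dg ->
  is_diff x (fun y => f y / g y : R^o)
    (fun h => df h / g x - f x * dg h / g x ^+ 2 : R^o).
Proof.
move=> gx fd gd.
have gVd : is_diff x (fun y => (g y)^-1 : R^o) (fun h => - (g x) ^- 2 * dg h : R^o).
  have gdd := ex_diff; apply: DiffDef; first exact: differentiableV.
  by rewrite diffV // diff_val.
apply: is_diff_ext (is_diff_mul fd gVd) => // h.
by rewrite mulNr mulrN mulrA mulrAC.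
Qed.

Lemma is_diff_sub (f g df dg : V -> R^o) x :
  is_diff x f df -> is_diff x g dg ->
  is_diff x (fun y => f y - g y : R^o) (fun h => df h - dg h : R^o).
Proof. by move=> fd gd; exact: is_diffB. Qed.

Lemma near_gt0 (I : finType) (f : I -> V -> R^o) x :
  (forall i, differentiable (f i) x) -> (forall i, 0 < f i x) ->
  \forall y \near x, forall i, 0 < f i y.
Proof.
move=> fd fx; apply: filter_forall => i.
have := differentiable_continuous (fd i) => /cvgr_gt; exact.
Qed.

(** The weights are frozen at the point [x] of differentiation, so the second-order terms of the two
    logarithms cancel there. What remains is minus the variance of [df i x h / f i x]. The index
    [i0] makes the sum nonempty, hence positive. *)
Lemma diff2_loglikelihood (I : finType) (i0 : I) (f : I -> V -> R^o)
    (df : I -> V -> V -> R^o) (x h : V) :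
  (forall i y, is_diff y (f i) (df i y)) ->
  (forall i, differentiable (fun y => df i y h) x) ->
  (forall i, 0 < f i x) ->
  diff2 (fun y => \sum_i f i x / (\sum_j f j x) * ln (f i y) -
    ln (\sum_j f j y) : R^o) x h h =
  - \sum_i f i x / (\sum_j f j x) *
      (df i x h / f i x - (\sum_j df j x h) / (\sum_j f j x)) ^+ 2.
Proof.
move=> fd d2 fx; set g := \sum_j f j x.
have gpos y : (forall i, 0 < f i y) -> 0 < \sum_j f j y.
  move=> fy; rewrite (bigD1 i0) //= ltr_pwDl // sumr_ge0 // => i _; exact: ltW.
have gx : 0 < g by exact: gpos.
have gd y : is_diff y (fun y => \sum_j f j y : R^o) (fun k => \sum_j df j y k : R^o).
  by apply: is_diff_sum => i _.
pose Psi y : R^o := \sum_i f i x / g * (df i y h / f i y) -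
  (\sum_j df j y h) / (\sum_j f j y).
have near_Psi : \forall z \near x, 'd (fun y => \sum_i f i x / g * ln (f i y) -
    ln (\sum_j f j y) : R^o) z h = Psi z.
  have : \forall y \near x, forall i, 0 < f i y.
    by apply: near_gt0 => // i; have [] := fd i x.
  apply: filterS => y fy.
  have D : is_diff y (fun y => \sum_i f i x / g * ln (f i y) -
      ln (\sum_j f j y) : R^o) (fun k => \sum_i f i x / g * (df i y k / f i y) -
      (\sum_j df j y k) / (\sum_j f j y) : R^o).
    apply: is_diff_sub; last by apply: is_diff_ln; first exact: gpos.
    by apply: is_diff_sum => i _; apply: is_diff_mulc; apply: is_diff_ln.
  by rewrite diff_val.
pose q i := 'd (fun y => df i y h) x.
have qd i : is_diff x (fun y => df i y h) (q i) by exact: differentiableP.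
have PsiD : is_diff x Psi (fun k => \sum_i f i x / g *
      (q i k / f i x - df i x h * df i x k / f i x ^+ 2) -
    ((\sum_j q j k) / g - (\sum_j df j x h) * (\sum_j df j x k) / g ^+ 2) : R^o).
  apply: is_diff_sub; last first.
    apply: is_diff_div; first exact: lt0r_neq0.
    by apply: is_diff_sum => i _.
  apply: is_diff_sum => i _; apply: is_diff_mulc; apply: is_diff_div.
  exact: lt0r_neq0.
have [Psi1 Psi2] := PsiD; rewrite /diff2 (diff_near_eq near_Psi Psi1) Psi2.
have g0 : g != 0 by exact: lt0r_neq0.
have f0 i : f i x != 0 by exact: lt0r_neq0.
set b := (\sum_j df j x h) / g.
(* The weight of [i] cancels the denominator [f i x]: [S1] matches the second-order terms, and [S2]
   identifies [b] as the mean. *)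
have S1 : \sum_i f i x / g * (q i h / f i x) = (\sum_j q j h) / g.
  rewrite mulr_suml; apply: eq_bigr => i _; by field; rewrite g0 f0.
have S2 : \sum_i f i x / g * (df i x h / f i x) = b.
  rewrite /b mulr_suml; apply: eq_bigr => i _; by field; rewrite g0 f0.
have S3 : \sum_i f i x / g = 1 by rewrite -mulr_suml divff.
transitivity (- (\sum_i f i x / g * (df i x h / f i x) ^+ 2) + b ^+ 2).
  under eq_bigr do rewrite mulrBr.
  have subrKB (a c d : R) : a - c - (a - d) = - c + d by ring.
  rewrite sumrB S1 subrKB; congr (_ + _); last first.
    by rewrite /b; field.
  by congr (- _); apply: eq_bigr => i _; field; rewrite g0 f0.
rewrite -[b ^+ 2]opprK -opprD; congr (- _).
transitivity (\sum_i (f i x / g * (df i x h / f i x) ^+ 2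
   - 2 * b * (f i x / g * (df i x h / f i x)) + b ^+ 2 * (f i x / g))); last first.
  by apply: eq_bigr => i _; field; rewrite g0 f0.
by rewrite big_split sumrB -!mulr_sumr S2 S3 /=; ring.
Qed.

End LogDifferentials.

(** * The Hessian on symmetric matrices *)

Section SymDifferentials.
Variables (R : realType) (N : nat).
Implicit Types (L H : sym R N) (J : {set 'I_N}).

Lemma sym_entry_le L i j : `|L i j| <= `|L|.
Proof.
change (`|L i j| <= `|sym_val L|); rewrite [leRHS]mx_normrE.
exact: (le_bigmax _ (fun ij : 'I_N * 'I_N => `|L ij.1 ij.2|) (i, j)).
Qed.

Definition sym_entry i j L : R^o := L i j.

Fact sym_entry_is_linear i j : linear (sym_entry i j).
Proof. by move=> a A B; rewrite /sym_entry /= !mxE. Qed.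

HB.instance Definition _ i j :=
  GRing.isLinear.Build R (sym R N) R^o *:%R (sym_entry i j) (sym_entry_is_linear i j).

Lemma is_diff_sym_entry i j L :
  is_diff L (fun A : sym R N => A i j : R^o) (fun H : sym R N => H i j : R^o).
Proof.
have c : continuous (sym_entry i j).
  apply/linear_bounded_continuous/bounded_funP => r; exists r => A Ar.
  exact: le_trans (sym_entry_le A i j) Ar.
have d : differentiable (sym_entry i j) L by exact: linear_differentiable.
by apply: DiffDef; [exact: d | exact: (diff_lin L c)].
Qed.

Lemma is_diff_det_mxsub n (v : 'I_n -> 'I_N) L :
  is_diff L (fun A : sym R N => \det (mxsub v v A) : R^o)
    (fun H : sym R N => ddet (mxsub v v L) (mxsub v v H) : R^o).
Proof.
apply: is_diff_det => i j.
by apply: is_diff_ext (is_diff_sym_entry (v i) (v j) L) => A; rewrite mxE.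
Qed.

(** Cofactors are signed determinants of smaller submatrices, so [is_diff_det] applies once more. *)
Lemma differentiable_ddet_mxsub n (v : 'I_n -> 'I_N) L H :
  differentiable (fun A : sym R N => ddet (mxsub v v A) (mxsub v v H) : R^o) L.
Proof.
have D : is_diff L (fun A : sym R N => ddet (mxsub v v A) (mxsub v v H) : R^o)
  (fun K : sym R N => \sum_i \sum_j (mxsub v v H) i j * ((-1) ^+ (i + j) *
     ddet (row' i (col' j (mxsub v v L))) (row' i (col' j (mxsub v v K)))) : R^o).
  apply: is_diff_sum => i _; apply: is_diff_sum => j _.
  apply: is_diff_mulc; apply: is_diff_mulc; apply: is_diff_det => a b.
  by apply: is_diff_ext (is_diff_sym_entry (v (lift i a)) (v (lift j b)) L) => A;
    rewrite !mxE.
by case: D.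
Qed.

(** Both sides are differentials at [L] of one and the same function of the matrix, so no cofactors
    have to be reindexed. *)
Lemma ddet_principal_codom n (v : 'I_n -> 'I_N) L H : injective v ->
  ddet (principal L [set v i | i : 'I_n]%SET) (principal H [set v i | i : 'I_n]%SET)
  = ddet (mxsub v v L) (mxsub v v H).
Proof.
move=> vI; rewrite !principalE.
set J := [set v i | i : 'I_n]%SET.
have D := is_diff_det_mxsub (enum_val : 'I_#|J| -> 'I_N) L.
have [_ /(congr1 (@^~ H)) <-] := is_diff_det_mxsub v L.
have [_ /(congr1 (@^~ H)) <-] := D.
by congr ('d _ _ _); apply/funext => A; rewrite -principalE det_principal_codom.
Qed.

(* [a J] is the derivative of [log det] at [L_J] in the direction [H_J] and [b]
   is its mean, so the right-hand side is minus a variance. *)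
Lemma hess_var L H : posdef L ->
  let a J := ddet (principal L J) (principal H J) / \det (principal L J) in
  let b := (\sum_J ddet (principal L J) (principal H J)) / \det (1%:M + L) in
  hess L H H = - \sum_J dpp_prob L J * (a J - b) ^+ 2.
Proof.
move=> Lpos /=; rewrite /hess.
(* Expanding the normalizing determinants into principal minors gives the shape required by
   [diff2_loglikelihood]. *)
have -> : (loglik L : sym R N -> R^o) = (fun A : sym R N =>
    \sum_J \det (principal L J) / (\sum_J \det (principal L J)) *
      ln (\det (principal A J)) - ln (\sum_J \det (principal A J)) : R^o).
  apply/funext => A; rewrite /loglik !det_add1_principal; congr (_ - _).
  by apply: eq_bigr => J _; rewrite /dpp_prob det_add1_principal.
have fd J (A : sym R N) : is_diff A (fun A : sym R N => \det (principal A J) : R^o)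
    (fun K : sym R N => ddet (principal A J) (principal K J) : R^o).
  apply: is_diff_ext (is_diff_det_mxsub (enum_val : 'I_#|J| -> 'I_N) A) => K;
    by rewrite !principalE.
have d2 J : differentiable
    (fun A : sym R N => ddet (principal A J) (principal H J) : R^o) L.
  have := differentiable_ddet_mxsub (enum_val : 'I_#|J| -> 'I_N) L H.
  by under eq_fun do rewrite -!principalE.
have fpos J : 0 < \det (principal L J) by exact: det_principal_gt0.
rewrite (diff2_loglikelihood finset.set0 fd d2 fpos).
by congr (- _); apply: eq_bigr => J _; rewrite /dpp_prob det_add1_principal.
Qed.

End SymDifferentials.

(** * Vanishing of the Hessian *)

Section HessianSign.
Variables (R : realType) (N : nat) (L : sym R N).
Hypothesis Lpos : posdef L.

Let prob_gt0 (J : {set 'I_N}) : 0 < dpp_prob L J.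
Proof.
rewrite divr_gt0 ?det_principal_gt0 // det_add1_principal.
rewrite (bigD1 finset.set0) //= ltr_pwDl ?det_principal_gt0 //.
by apply: sumr_ge0 => J' _; rewrite ltW // det_principal_gt0.
Qed.

Lemma hess_le0 H : hess L H H <= 0.
Proof.
rewrite hess_var // oppr_le0; apply: sumr_ge0 => J _.
by rewrite mulr_ge0 ?sqr_ge0 // ltW.
Qed.

Lemma hess_eq0 H : hess L H H = 0 <->
  forall J : {set 'I_N}, ddet (principal L J) (principal H J) = 0.
Proof.
rewrite hess_var //; split=> [/eqP|dH].
  set b := _ / \det (1%:M + L).
  rewrite oppr_eq0 psumr_eq0 => [/allP e0 J|J _]; last first.
    by rewrite mulr_ge0 ?sqr_ge0 // ltW.
  have aE J' : ddet (principal L J') (principal H J') / \det (principal L J') = b.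
    have := e0 J' (mem_index_enum _); rewrite mulf_eq0 sqrf_eq0 subr_eq0.
    by rewrite (gt_eqF (prob_gt0 _)) => /eqP.
  (* For the empty set the sum defining [ddet] has no term, which forces the common value [b] to be
     0. *)
  have := aE J; rewrite -(aE finset.set0) [ddet (principal L finset.set0) _]big1.
    move/eqP; rewrite mul0r mulf_eq0 invr_eq0 (gt_eqF (det_principal_gt0 _ _)) //.
    by rewrite orbF => /eqP.
  by move=> i _; have := ltn_ord i; rewrite [X in (_ < X)%N]cards0.
rewrite big1 ?oppr0 // => J _; rewrite dH mul0r big1 //.
by rewrite mul0r subr0 expr0n mulr0.
Qed.

End HessianSign.

(** * Determinant derivatives of matrices with prescribed support *)

Section DdetSupport.
Variable R : comNzRingType.

(* A permutation all of whose steps but the one at [i] stay within classes of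
   [r] also maps [i] within its class, because [i] closes the cycle. *)
Lemma perm_step_rel n (r : rel 'I_n) (s : 'S_n) i :
  reflexive r -> symmetric r -> transitive r ->
  (forall k, k != i -> r k (s k)) -> r i (s i).
Proof.
move=> rr rs rt rk; rewrite rs.
(* The orbit is followed from [s i]; if it meets [i], the next point is [s i] again and reflexivity
   suffices. After [#[s]%g.-1] steps it is back at [i]. *)
have it m : r (s i) ((s ^+ m)%g (s i)).
  elim: m => [|m IH]; first by rewrite expg0 perm1.
  rewrite expgSr permM; set k := (s ^+ m)%g (s i) in IH *.
  have [->|ki] := eqVneq k i; first exact: rr.
  exact: rt IH (rk _ ki).
have := it #[s]%g.-1; rewrite -permM -expgS prednK ?order_gt0 //.
by rewrite expg_order perm1.
Qed.

(** In each Leibniz term, either some factor of [A] vanishes, or all steps but the one at [i] follow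
    [r]; then [perm_step_rel] makes the factor of [B] vanish. *)
Lemma ddet_support0 n (A B : 'M[R]_n) (r : rel 'I_n) :
  reflexive r -> symmetric r -> transitive r ->
  (forall i j, A i j != 0 -> r i j) -> (forall i j, r i j -> B i j = 0) ->
  ddet A B = 0.
Proof.
move=> rr rs rt Ar Br; rewrite ddetE big1 // => s _; rewrite big1 ?mulr0 // => i _.
have [k /andP[ki Ak]|ne] := pickP (fun k => (k != i) && (A k (s k) == 0)).
  by rewrite (bigD1 k) //= (eqP Ak) mul0r mulr0.
rewrite Br ?mul0r //; apply: perm_step_rel => // k ki; apply: Ar.
by have := ne k; rewrite ki /= => /negbT.
Qed.

End DdetSupport.

Lemma ddet_tridiagonal_corner (R : realType) n (A B : 'M[R]_n.+1) :
  A^T = A -> B^T = B ->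
  (forall i j : 'I_n.+1, (i.+1 < j)%N -> A i j = 0) ->
  (forall i j : 'I_n.+1, (i.+1 == j)%N -> A i j != 0) ->
  (forall i j : 'I_n.+1, (i <= j)%N -> (j - i < n)%N -> B i j = 0) ->
  ddet A B = 0 -> B ord0 ord_max = 0.
Proof.
move=> AT BT A0 A1 B0 dAB.
(* Only corner entries of [B] survive, all equal to [h] and with the same nonzero
   cofactor [c]; so [ddet A B * h] is [c] times a sum of terms 0 or [h ^+ 2]. *)
pose h := B ord0 ord_max; pose c := cofactor A ord_max ord0.
(* Deleting the last row and the first column leaves a lower triangular matrix whose diagonal is the
   superdiagonal of [A]. *)
have c0 : c != 0.
  rewrite /c /cofactor mulf_neq0 ?signr_eq0 // det_trig.
    apply/prodf_neq0 => i _; rewrite !mxE; apply: A1.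
    by rewrite lift_max lift0.
  apply/is_trig_mxP => i j ij; rewrite !mxE; apply: A0.
  by rewrite lift_max lift0.
have cT : cofactor A ord0 ord_max = c by rewrite -cofactor_tr AT.
have ut (i j : 'I_n.+1) : (i <= j)%N ->
    B i j * cofactor A i j = B i j * c /\ 0 <= B i j * h.
  move=> ij; have [lt|ge] := ltnP (j - i) n.
    by rewrite B0 // !mul0r.
  have -> : i = ord0 by apply: val_inj => /=; have := ltn_ord j; lia.
  have -> : j = ord_max by apply: val_inj => /=; have := ltn_ord j; lia.
  by rewrite cT -expr2 sqr_ge0.
have all_ij (i j : 'I_n.+1) : B i j * cofactor A i j = B i j * c /\ 0 <= B i j * h.
  have [ij|ji] := leqP i j; first exact: ut.
  have -> : B i j = B j i by rewrite -[in LHS]BT mxE.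
  have -> : cofactor A i j = cofactor A j i by rewrite -[in LHS]AT cofactor_tr.
  exact/ut/ltnW.
have := dAB; rewrite /ddet.
under eq_bigr do under eq_bigr do rewrite (proj1 (all_ij _ _)).
under eq_bigr do rewrite -mulr_suml; rewrite -mulr_suml => /eqP.
rewrite mulf_eq0 (negPf c0) orbF => /eqP /(congr1 ( *%R^~ h)).
rewrite mul0r mulr_suml; under eq_bigr do rewrite mulr_suml.
have ge0 i : 0 <= \sum_j B i j * h by apply: sumr_ge0 => j _; case: (all_ij i j).
move/eqP; rewrite psumr_eq0 // => /allP /(_ ord0 (mem_index_enum _)) /=.
rewrite psumr_eq0 => [|j _]; last by case: (all_ij ord0 j).
move=> /allP /(_ ord_max (mem_index_enum _)) /=.
by rewrite mulf_eq0 orbb => /eqP.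
Qed.

(** * Geodesics in the determinantal graph *)

Section Walks.
Variables (T : Type) (e : rel T).

(** With a total function on [nat], segments are mere shifts; values beyond [n] are irrelevant. *)
Definition walk n i j := exists v : nat -> T,
  [/\ v 0%N = i, v n = j & forall k, (k < n)%N -> e (v k) (v k.+1)].

Lemma walk_cat m n i j k : walk m i j -> walk n j k -> walk (m + n) i k.
Proof.
move=> [v [v0 vm ve]] [w [w0 wn we]].
exists (fun a => if (a <= m)%N then v a else w (a - m)%N); split=> [//||a an].
  case: leqP => h; last by rewrite addKn.
  have n0 : n = 0%N by lia.
  by move: wn; rewrite n0 addn0 w0 vm.
case: (leqP a.+1 m) => h; first by rewrite (ltnW h) ve.
have -> : (a.+1 - m = (a - m).+1)%N by lia.
case: (leqP a m) => h'; last by apply: we; lia.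
have -> : a = m by lia.
by rewrite subnn vm -w0; apply: we; lia.
Qed.

Lemma walk_segment (v : nat -> T) n a b :
  (forall k, (k < n)%N -> e (v k) (v k.+1)) -> (a <= b <= n)%N ->
  walk (b - a) (v a) (v b).
Proof.
move=> ve /andP[ab bn]; exists (fun k => v (a + k)%N); split.
- by rewrite addn0.
- by rewrite subnKC.
- by move=> k kb; rewrite addnS; apply: ve; lia.
Qed.

Definition geodesic n i j := walk n i j /\ forall m, walk m i j -> (n <= m)%N.

Lemma walk_geodesic n i j : walk n i j -> exists m, geodesic m i j.
Proof.
move=> wn; have ex : exists m, `[< walk m i j >] by exists n; apply/asboolP.
exists (ex_minn ex); case: ex_minnP => m /asboolP wm min; split=> // k wk.
by apply: min; apply/asboolP.
Qed.

(** A shorter walk from [v a] to [v b], spliced between the two remaining pieces, would shorten the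
    whole geodesic. *)
Lemma geodesic_segment (v : nat -> T) n a b :
  (forall k, (k < n)%N -> e (v k) (v k.+1)) -> geodesic n (v 0%N) (v n) ->
  (a <= b <= n)%N -> geodesic (b - a) (v a) (v b).
Proof.
move=> ve [_ min] abn; split; first exact: walk_segment ve abn.
move=> m wm; case/andP: abn => ab bn.
have w1 := @walk_segment v n 0 a ve; rewrite subn0 in w1.
have w2 := @walk_segment v n b n ve.
have := min _ (walk_cat (walk_cat (w1 _) wm) (w2 _)).
by rewrite leq0n (leq_trans ab bn) bn leqnn /= => /(_ isT isT); lia.
Qed.

End Walks.

Lemma connect_walk (T : finType) (e : rel T) i j :
  connect e i j -> exists n, walk e n i j.
Proof.
move=> /connectP[p ep ->]; exists (size p), (nth i (i :: p)); split=> //.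
  exact: nth_last.
by move=> k kp; have /(pathP i) := ep; apply.
Qed.

(** * The null space of the Hessian *)

Section NullSpace.
Variables (R : realType) (N : nat) (L : sym R N).
Hypothesis Lpos : posdef L.

Lemma sym_entryC (A : sym R N) i j : A i j = A j i.
Proof. by have := valP A; rewrite is_symE => /eqP h; rewrite -{1}h mxE. Qed.

Lemma graph_equiv_sym : symmetric (graph_equiv L).
Proof.
by apply: sym_connect_sym => i j; rewrite /det_graph /= eq_sym sym_entryC.
Qed.

(** Strong induction on [n]; the case [n = 0], with a 1 x 1 submatrix, yields the diagonal entries
    of [H]. *)
Lemma ddet0_geodesic (H : sym R N) n :
  (forall J : {set 'I_N}, ddet (principal L J) (principal H J) = 0) ->
  forall i j, geodesic (det_graph L) n i j -> H i j = 0.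
Proof.
move=> dH; have [m] := ubnP n; elim: m n => // m IH n /ltnSE nm i j gij.
have [[v [v0 vn ve]] min] := gij; rewrite -v0 -vn in gij min *.
have seg a b := @geodesic_segment _ _ v n a b ve gij.
have vdist a b k : (a <= b <= n)%N -> walk (det_graph L) k (v a) (v b) ->
    (b - a <= k)%N by move=> /seg [_ h] /h.
pose w (k : 'I_n.+1) := v k.
have wI : injective w.
  move=> a b wab; apply: val_inj; wlog ab : a b wab / (a <= b)%N.
    by move=> h; case/orP: (leq_total a b) => /h; [exact|move=> ->].
  (* A repeated vertex would give a walk of length 0 between two positions of the geodesic. *)
  have : (b - a <= 0)%N.
    apply: vdist; first by rewrite ab -ltnS ltn_ord.
    by exists (fun=> v a); split=> //; exact: wab.
  by move=> ba; apply/eqP; rewrite eqn_leq ab -subn_eq0 -leqn0.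
have dw : ddet (mxsub w w L) (mxsub w w H) = 0.
  by rewrite -ddet_principal_codom // dH.
have symT (A : sym R N) : (mxsub w w A)^T = mxsub w w A.
  by apply/matrixP => a b; rewrite !mxE sym_entryC.
have := ddet_tridiagonal_corner (symT L) (symT H) _ _ _ dw.
rewrite !mxE; apply=> a b; rewrite !mxE.
(* A nonzero entry of [L] is an edge, that is a walk of length 1, so the positions differ by at most
   1. *)
- move=> ab; apply/eqP; apply: contraTT ab => Lab; rewrite -leqNgt.
  have [ab|ba] := leqP a b; last exact: leqW (ltnW ba).
  have [->|nab] := eqVneq a b; first exact: leqnSn.
  have : (b - a <= 1)%N; last by lia.
  apply: vdist; first by rewrite ab -ltnS ltn_ord.
  exists (fun k => if k is 0%N then w a else w b); split=> // -[] //= _.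
  by rewrite /det_graph /= (inj_eq wI) nab.
- move=> /eqP ab; have /andP[] // : det_graph L (w a) (w b).
  by rewrite /w -ab; apply: ve; have := ltn_ord b; lia.
- move=> ab ban; apply: (IH (b - a)%N); first exact: leq_trans ban nm.
  by apply: seg; rewrite ab -ltnS ltn_ord.
Qed.

Lemma null_space (H : sym R N) : hess L H H = 0 <->
  forall i j, graph_equiv L i j -> H i j = 0.
Proof.
apply: (iff_trans (hess_eq0 Lpos H)).
split=> [dH i j ij|Hr J].
  have [n wn] := connect_walk ij; have [m gm] := walk_geodesic wn.
  exact: ddet0_geodesic gm.
(* The relation is connectivity in the whole graph, pulled back to the indices of [J], rather than
   connectivity inside [J]. *)
apply: (@ddet_support0 _ _ _ _ (fun a b => graph_equiv L (enum_val a) (enum_val b))).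
- by move=> a; exact: connect0.
- by move=> a b; exact: graph_equiv_sym.
- by move=> b a c; exact: connect_trans.
- move=> a b; rewrite mxE => Lab.
  have [->|ab] := eqVneq (enum_val a) (enum_val b); first exact: connect0.
  by apply: connect1; rewrite /det_graph /= ab.
- by move=> a b; rewrite mxE; exact: Hr.
Qed.

End NullSpace.

(** * Irreducibility *)

Section Irreducible.
Variables (R : realType) (N : nat) (L : sym R N).

(* The conjugate of [L] by the diagonal matrix with entry -1 exactly on [S]. *)
Definition flip (S : {set 'I_N}) : 'M[R]_N :=
  \matrix_(i, j) ((-1) ^+ (i \in S) * (-1) ^+ (j \in S) * L i j).

Lemma sign_diag_orbit :
  [set D *m L *m D | D in @sign_diag R N] = range flip.
Proof.
apply/seteqP; split=> [_ [D [/is_diag_mxP Dd Ds] <-]|_ [S _ <-]].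
  exists [set i | D i i == -1]%SET => //.
  have DE : D = diag_mx (\row_i (-1) ^+ (D i i == -1)).
    apply/matrixP => i j; rewrite !mxE.
    have [<-|ij] := eqVneq i j; last by rewrite mulr0n Dd.
    rewrite mulr1n; case: (Ds i) => ->; last by rewrite eqxx.
    by rewrite (gt_eqF (lt_trans (ltrN10 R) ltr01)).
  rewrite [in RHS]DE mul_diag_mx mul_mx_diag; apply/matrixP => i j.
  by rewrite !mxE !inE mulrAC.
exists (diag_mx (\row_i (-1) ^+ (i \in S))).
  split; first exact: diag_mx_is_diag.
  by move=> i; rewrite !mxE eqxx mulr1n; case: (i \in S); [right|left].
rewrite mul_diag_mx mul_mx_diag; apply/matrixP => i j.
by rewrite !mxE mulrAC.
Qed.

(** [C] is a union of components, so the ends of each edge change sign together and the two changes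
    cancel. *)
Lemma flip_addb (S C : {set 'I_N}) :
  (forall i j, graph_equiv L i j -> (i \in C) = (j \in C)) ->
  flip [set k | (k \in S) (+) (k \in C)]%SET = flip S.
Proof.
move=> Cc; apply/matrixP => i j; rewrite !mxE !inE !signr_addb.
have [->|Lij] := eqVneq (L i j) 0; first by rewrite !mulr0.
have -> : (i \in C) = (j \in C).
  have [->//|ij] := eqVneq i j; apply: Cc; apply: connect1.
  by rewrite /det_graph /= ij.
by congr (_ * _); rewrite mulrACA -expr2 sqrr_sign mulr1.
Qed.

Lemma card_set_of_finset (P : {set {set 'I_N}}) :
  [set` P] #= `I_(#|P|).
Proof.
have -> : [set` P] = (enum_val : 'I_#|P| -> _) @` setT.
  apply/seteqP; split=> [S SP|_ [k _ <-]]; last exact: enum_valP.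
  by exists (enum_rank_in SP S) => //; rewrite enum_rankK_in.
rewrite (card_eqr card_II); apply: inj_card_eq => a b _ _; exact: enum_val_inj.
Qed.

Lemma irreducibleP (i0 : 'I_N) :
  irreducible L <-> forall i j, graph_equiv L i j.
Proof.
have flipC S : flip (~: S)%SET = flip S.
  rewrite -[RHS](@flip_addb S [set: 'I_N]%SET) => [|i j _]; last by rewrite !inE.
  by congr flip; apply/setP => k; rewrite !inE addbT.
rewrite /irreducible sign_diag_orbit; split=> [irr i j|conn].
  apply: contrapT => /negP nij.
  pose C := [set k | graph_equiv L i k]%SET.
  have Cc a b : graph_equiv L a b -> (a \in C) = (b \in C).
    rewrite !inE => ab; apply/idP/idP => h; apply: connect_trans h _ => //.
    by have := graph_equiv_sym L a b; rewrite ab => /esym.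
  (* Complementing [S], or flipping it on [C], preserves [flip S], so sets avoiding
     both [i] and [j] suffice: the orbit has at most 2^(N-2) elements. *)
  pose P := powerset (~: [set i; j])%SET.
  have sub : range flip `<=` flip @` [set` P].
    have avoid_i (S : {set 'I_N}) : i \notin S -> (flip @` [set` P]) (flip S).
      move=> iS; have [jS|jS] := boolP (j \in S); last first.
        exists S => //=; rewrite powersetE; apply/fintype.subsetP => k kS.
        by rewrite !inE; apply/norP; split; apply: contraTneq kS => ->.
      (* Both [~: S] and [C] contain [i] and not [j], so their symmetric difference avoids both. *)
      exists [set k | (k \in ~: S) (+) (k \in C)]%SET; last by rewrite flip_addb.
      rewrite /= powersetE; apply/fintype.subsetP => k; rewrite !inE => h.
      apply/norP; split; apply: contraTneq h => ->.
        by rewrite iS /graph_equiv connect0.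
      by rewrite jS (negPf nij).
    move=> _ [S _ <-]; have [iS|] := boolP (i \in S); last exact: avoid_i.
    by rewrite -flipC; apply: avoid_i; rewrite inE negbK.
  have : `I_(2 ^ N.-1) #<= `I_(#|P|).
    rewrite -(card_le_eql irr) -(card_le_eqr (card_set_of_finset P)).
    exact: card_le_trans (subset_card_le sub) (card_image_le _ _).
  have inj : i != j by apply: contraNneq nij => ->; exact: connect0.
  (* Since [i] and [j] are distinct, [N] is at least 2, so [N.-1 <= N - 2] fails despite truncated
     subtraction. *)
  rewrite card_le_II card_powerset leq_exp2l // cardsCs finset.setCK cards2 inj card_ord.
  by have := ltn_ord i; have := ltn_ord j; move: inj; rewrite -val_eqE /=; lia.
(* Up to complement a set avoids [i0]; there are [2 ^ N.-1] such sets, and [flip] is shown injective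
   on them. *)
pose P := powerset (~: [set i0])%SET.
have -> : range flip = flip @` [set` P].
  apply/seteqP; split=> [_ [S _ <-]|_ [S _ <-]]; last by exists S.
  have i0P (S' : {set 'I_N}) : i0 \notin S' -> S' \in P.
    move=> iS; rewrite powersetE; apply/fintype.subsetP => k kS; rewrite !inE.
    by apply: contraNneq iS => <-.
  have [iS|/i0P SP] := boolP (i0 \in S); last by exists S.
  by exists (~: S)%SET; [apply: i0P; rewrite inE negbK|exact: flipC].
have cP : #|P| = (2 ^ N.-1)%N.
  by rewrite card_powerset cardsCs finset.setCK cards1 card_ord subn1.
rewrite -cP -(card_eqr (card_set_of_finset P)); apply: inj_card_eq.
move=> S S' /set_mem SP /set_mem S'P /matrixP FS.
have i0S S0 : S0 \in P -> i0 \notin S0.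
  by rewrite powersetE => /fintype.subsetP sS; apply/negP => /sS; rewrite !inE eqxx.
(* On an edge the nonzero entry of [L] can be cancelled in the equality of flips, so the symmetric
   difference of [S] and [S'] is constant along paths. *)
have step a b : graph_equiv L a b ->
    (a \in S) (+) (a \in S') = (b \in S) (+) (b \in S').
  move=> /connectP[p]; elim: p a => [a _ -> //|c p IH a /= /andP[/andP[_ ac] cp] bE].
  rewrite -(IH c) //; have := FS a c; rewrite !mxE => /(mulIf ac).
  rewrite -!signr_addb => /signr_inj.
  by case: (a \in S); case: (c \in S); case: (a \in S'); case: (c \in S').
apply/setP => k; have := step _ _ (conn k i0).
by rewrite (negPf (i0S _ SP)) (negPf (i0S _ S'P)); case: (k \in S); case: (k \in S').
Qed.

End Irreducible.

Theorem theorem8 (R : realType) (N : nat) (hN : (1 <= N)%N)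
    (Lstar : sym R N) (hL : posdef Lstar) :
  [set H : sym R N | hess Lstar H H = 0] =
  [set H : sym R N | forall i j : 'I_N, graph_equiv Lstar i j -> H i j = 0] /\
  ((forall H : sym R N, H != 0 -> hess Lstar H H < 0) <-> irreducible Lstar).
Proof.
split; first by apply/seteqP; split=> H /(null_space hL).
rewrite (irreducibleP Lstar (Ordinal hN)); split=> [neg i j|conn H H0].
  apply: contrapT => /negP nij.
  (* If [i] and [j] were not connected, this symmetric matrix would be a nonzero null direction,
     being supported on pairs from distinct components. *)
  pose M : 'M[R]_N := delta_mx i j + delta_mx j i.
  have MS : M \in @Defs.is_sym R N.
    by rewrite is_symE linearD /= !trmx_delta addrC.
  have M0 : Defs.Sym MS != 0.
    apply/eqP => /(congr1 (fun A : sym R N => A i j)).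
    rewrite /= !mxE !eqxx /= => /eqP; case: (_ && _); rewrite ?addr0 ?oner_eq0 //.
    by rewrite -natrD pnatr_eq0.
  have := neg _ M0; rewrite (proj2 (null_space hL _)) ?ltxx // => a b ab.
  rewrite /= !mxE; case: andP => [[/eqP ai /eqP bj]|_].
    by rewrite -ai -bj ab in nij.
  case: andP => [[/eqP aj /eqP bi]|_]; last by rewrite addr0.
  by rewrite -aj -bi graph_equiv_sym ab in nij.
rewrite lt_neqAle hess_le0 // andbT; apply: contra_neq H0 => /(null_space hL) h.
by apply: val_inj; apply/matrixP => i j; rewrite h ?mxE.
Qed.
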